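(* Let $f$ be a function holomorphic near $0$, let $R\in(0,\infty]$ be the radius of convergence of its Taylor series at $0$, and let $\alpha,\beta$ be complex numbers with $\alpha\neq -1$, $\beta\neq 0$ and $-\frac{\alpha+1}{\beta}\notin\mathbb{N}=\{1,2,3,\dots\}$. Then $$\int x^\alpha f(x^\beta)\,dx=\frac{x^{\alpha+1}}{\alpha+1}\, f\left(\left.\begin{array}{c}\frac{\alpha+1}{\beta}\\ 1+\frac{\alpha+1}{\beta}\end{array}\right| x^{\beta}\right)+c ,$$ where $c$ is an arbitrary constant. That is, the function $\frac{x^{\alpha+1}}{\alpha+1}\sum_{k=0}^\infty \frac{f^{(k)}(0)}{k!}\frac{\left(\frac{\alpha+1}{\beta}\right)_k}{\left(1+\frac{\alpha+1}{\beta}\right)_k}x^{\beta k}$ is an antiderivative of $x^\alpha f(x^\beta)$ for $|x^\beta|<R$.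
   Context: The Pochhammer symbol is $(a)_k=a(a+1)\cdots(a+k-1)$, $(a)_0=1$. For $f$ holomorphic near $0$ and complex numbers $a,c$ with $1-c\notin\mathbb{N}=\{1,2,3,\dots\}$, the hypergeometrization of $f$ is $$f\left(\left.\begin{array}{c}a\\ c\end{array}\right| x\right):=\sum_{k=0}^{\infty}\frac{f^{(k)}(0)}{k!}\frac{(a)_k}{(c)_k}x^k .$$ An identity $\int g(x)\,dx=G(x)+c$ means that $G'(x)=g(x)$. Here $x$ ranges over any open connected set $U\subset\mathbb{C}\setminus\{0\}$ (or open interval of $(0,\infty)$) on which a branch of $\log x$ is fixed, powers are $x^s=\exp(s\log x)$ with this branch, and $|x^\beta|<R$ on $U$. On such a set $f(x^\beta)$ denotes the sum of the Taylor series of $f$ at $x^\beta$. *)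

(* Defs.v *)
From Stdlib Require Import Reals Factorial.
From Coquelicot Require Import Coquelicot.
Open Scope R_scope.
Open Scope C_scope.

Definition Cexp (z : C) : C := RtoC (exp (Re z)) * (cos (Im z), sin (Im z)).

Fixpoint C_derive_n (f : C -> C) (n : nat) : C -> C :=
  match n with
  | O => f
  | S m => C_derive (C_derive_n f m)
  end.

Definition holomorphic_near (f : C -> C) (z0 : C) : Prop :=
  locally (T := C_UniformSpace) z0
    (fun z => ex_derive (K := C_AbsRing) (V := C_NormedModule) f z).

Fixpoint pochhammer (a : C) (k : nat) : C :=
  match k with
  | O => 1
  | S m => pochhammer a m * (a + INR m)
  end.

Definition C_ex_series (a : nat -> C) : Prop :=
  ex_series (K := C_AbsRing) (V := C_NormedModule) a.

(* Like [Series], this is the sum of [a] only when [C_ex_series a] holds. *)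
Definition C_Series (a : nat -> C) : C :=
  (Series (fun k => Re (a k)), Series (fun k => Im (a k))).

Definition taylor_coef (f : C -> C) (k : nat) : C :=
  C_derive_n f k 0 / INR (fact k).

Definition taylor_term (f : C -> C) (z : C) (k : nat) : C :=
  taylor_coef f k * z ^ k.

(* The value at [z] of the Taylor series of [f] at 0, which need not be [f z]
   even where the series converges. *)
Definition taylor_sum (f : C -> C) (z : C) : C :=
  C_Series (taylor_term f z).

Definition taylor_radius (f : C -> C) : Rbar :=
  Lub_Rbar (fun r : R => exists z : C, Cmod z = r /\ C_ex_series (taylor_term f z)).

Definition hypergeom_term (f : C -> C) (a c x : C) (k : nat) : C :=
  taylor_coef f k * (pochhammer a k / pochhammer c k) * x ^ k.

Definition hypergeometrization (f : C -> C) (a c x : C) : C :=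
  C_Series (hypergeom_term f a c x).

Definition C_connected (U : C -> Prop) : Prop :=
  forall A B : C -> Prop,
    open (T := C_UniformSpace) A -> open (T := C_UniformSpace) B ->
    (forall z, U z -> A z \/ B z) ->
    (exists z, U z /\ A z) -> (exists z, U z /\ B z) ->
    exists z, U z /\ A z /\ B z.

Definition log_branch (U : C -> Prop) (L : C -> C) : Prop :=
  forall x, U x ->
    continuous (T := C_UniformSpace) (U := C_UniformSpace) L x /\ Cexp (L x) = x.

Definition log_branch_R (I : R -> Prop) (L : R -> C) : Prop :=
  forall x, I x ->
    continuous (T := R_UniformSpace) (U := C_UniformSpace) L x /\
    Cexp (L x) = RtoC x.

(* The power [x ^ s] is taken with respect to the chosen value [l] of [log x]. *)
Definition Cpower (l s : C) : C := Cexp (s * l).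

(* Main.v *)
Require Import Defs.
From Stdlib Require Import Reals Lra Lia.
From Coquelicot Require Import Coquelicot.
Open Scope R_scope.
Open Scope C_scope.

(** Write [a = (alpha+1)/beta], [c_k] for the Taylor coefficients of [f] and
    [b_k = c_k (a)_k / (1+a)_k].  The Pochhammer quotient telescopes to
    [a/(a+k)], so that [(a + k) b_k = a c_k] ([hypergeom_coef_shift]).  Summed
    against [w^k], this is the differential equation
    [a P(w) + w P'(w) = a S(w)] between the hypergeometrization [P] and the
    Taylor sum [S] ([hypergeom_diff_eq]).

    As functions of [l = log x], with [w = exp (beta l)], the proposed
    antiderivative [exp ((alpha+1) l) P(w) / (alpha+1)] therefore has derivative
    [exp ((alpha+1) l) (P(w) + beta w P'(w) / (alpha+1)) = exp ((alpha+1) l) S(w)].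
    Since [x = exp l], the chosen branch satisfies [dl/dx = 1/x], and
    [exp ((alpha+1) l) / x = x^alpha]: this is [deriv_wrt_antiderivative].

    The analytic input is elementary.  The ratios [a/(a+k)] are bounded, so the
    radius of convergence of [P] is at least that of [S].  Complex power series
    are differentiated termwise by summing the second-order estimate
    [pow_taylor1_le] for monomials, the sum of the errors being controlled by
    the twice derived real series of absolute values.  The exponential is
    differentiated through its real and imaginary parts.

    The complex and the real case are one computation: [deriv_wrt] speaks of the
    derivative of one complex function with respect to another along an
    arbitrary filter, and only the neighbourhood filter (of a point of the plane
    or of the line) differs.  It also lets the derivative of a continuous
    branch of [log] be obtained by inverting [d exp(l) / dl = exp l]
    ([deriv_wrt_log]). *)

Notation C_is_series := (is_series (K := C_AbsRing) (V := C_NormedModule)).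

(** * Series of complex numbers *)

(** Both coordinates are additive and continuous, so they commute with sums. *)
Lemma C_is_series_unique (a : nat -> C) (l : C) :
  C_is_series a l -> C_Series a = l.
Proof.
  assert (comp : forall p : C -> R,
    (forall x y : C, p (x + y) = (p x + p y)%R) ->
    continuous (T := C_UniformSpace) (U := R_UniformSpace) p l ->
    C_is_series a l -> Series (fun k => p (a k)) = p l).
  { intros p padd pcont al. apply is_series_unique.
    unfold is_series.
    apply filterlim_ext with (fun n => p (sum_n (G := C_AbelianMonoid) a n)).
    - induction x as [|n IHn]; [now rewrite !sum_O|].
      rewrite !sum_Sn, <- IHn. apply padd.
    - exact (filterlim_comp _ _ _ _ _ _ _ _ al pcont). }
  intros al. unfold C_Series.
  rewrite (comp Re), (comp Im); try assumption; try reflexivity.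
  - now destruct l.
  - apply (continuous_snd (U := R_UniformSpace) (V := R_UniformSpace)).
  - apply (continuous_fst (U := R_UniformSpace) (V := R_UniformSpace)).
Qed.

Lemma C_Series_correct (a : nat -> C) :
  C_ex_series a -> C_is_series a (C_Series a).
Proof. intros [l al]. now rewrite (C_is_series_unique a l). Qed.

(** The triangle inequality for infinite sums. *)
Lemma C_is_series_mod_le (a : nat -> C) (A : nat -> R) (l : C) :
  (forall k, Cmod (a k) <= A k)%R -> ex_series A -> C_is_series a l ->
  Cmod l <= Series A.
Proof.
  intros aA HA al.
  apply (filterlim_le (F := eventually)
           (fun n => norm (sum_n (G := C_AbelianMonoid) a n))
           (sum_n A) (Cmod l) (Series A)).
  - apply filter_forall. intros n.
    eapply Rle_trans;
      [exact (norm_sum_n_m (V := C_NormedModule) a 0 n)|].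
    apply sum_n_m_le. exact aA.
  - exact (filterlim_comp _ _ _ _ _ _ _ _ al
             (filterlim_norm (V := C_NormedModule) l)).
  - exact (Series_correct A HA).
Qed.

Lemma C_ex_series_bounded (a : nat -> C) :
  C_ex_series a -> exists M, forall k, Cmod (a k) <= M.
Proof.
  intros al.
  destruct (filterlim_bounded (V := C_NormedModule) _ al) as [M HM].
  exists (M + M)%R. intros [|k].
  - specialize (HM 0%nat). rewrite sum_O in HM. change (Cmod (a 0%nat) <= M) in HM.
    pose proof (Cmod_ge_0 (a 0%nat)). lra.
  - pose proof (HM k) as H1. pose proof (HM (S k)) as H2. rewrite sum_Sn in H2.
    set (s := sum_n (G := C_AbelianMonoid) a k) in *.
    change (Cmod (s + a (S k)) <= M) in H2. change (Cmod s <= M) in H1.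
    replace (a (S k)) with ((s + a (S k)) + - s) by ring.
    eapply Rle_trans; [apply Cmod_triangle|]. rewrite Cmod_opp. lra.
Qed.

(** * Complex power series *)

(** Defined through the moduli so that the real theory of power series applies
    to complex coefficients. *)
Definition abs_radius (b : nat -> C) : Rbar := CV_radius (fun k => Cmod (b k)).

Definition diff_coef (b : nat -> C) (k : nat) : C := INR (S k) * b (S k).

Lemma Cmod_INR (n : nat) : Cmod (INR n) = INR n.
Proof. rewrite Cmod_R. apply Rabs_pos_eq, pos_INR. Qed.

Lemma abs_radius_diff_coef (b : nat -> C) :
  abs_radius (diff_coef b) = abs_radius b.
Proof.
  unfold abs_radius. rewrite <- (CV_radius_derive (fun k => Cmod (b k))).
  apply CV_radius_ext.
  intros k. unfold PS_derive, diff_coef. now rewrite Cmod_mult, Cmod_INR.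
Qed.

Lemma ex_series_nonneg_inside (a : nat -> R) (r : R) :
  (forall k, 0 <= a k)%R -> (0 <= r)%R -> Rbar_lt r (CV_radius a) ->
  ex_series (fun k => (a k * r ^ k)%R).
Proof.
  intros a0 r0 Hr.
  apply ex_series_ext with (fun k => Rabs (a k * r ^ k)).
  - intros k. apply Rabs_pos_eq. apply Rmult_le_pos; [apply a0|now apply pow_le].
  - apply CV_disk_inside. now rewrite Rabs_pos_eq.
Qed.

Lemma ex_pow_series (b : nat -> C) (z : C) :
  Rbar_lt (Cmod z) (abs_radius b) -> C_ex_series (fun k => b k * z ^ k).
Proof.
  intros Hz.
  apply (ex_series_le (V := C_CompleteNormedModule) _
           (fun k => (Cmod (b k) * Cmod z ^ k)%R)).
  - intros k. change (Cmod (b k * z ^ k) <= Cmod (b k) * Cmod z ^ k)%R.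
    rewrite Cmod_mult, Cmod_pow. apply Rle_refl.
  - apply ex_series_nonneg_inside; try apply Cmod_ge_0; [|exact Hz].
    intros k. apply Cmod_ge_0.
Qed.

(** Writing [E_n] for the remainder of [w^n] at [z] and [h = w - z], one has
    [E_(n+1) = w E_n + n z^(n-1) h^2], and the bound follows by induction. The
    constant [(k+1)(k+2)] is the one produced by deriving a power series twice,
    which is what makes the bounds summable. *)
Lemma pow_taylor1_le (z w : C) (r : R) (k : nat) :
  (Cmod z <= r)%R -> (Cmod w <= r)%R ->
  (Cmod (w ^ (S (S k)) - z ^ (S (S k)) - INR (S (S k)) * z ^ (S k) * (w - z))
   <= INR (S k) * INR (S (S k)) * r ^ k * Cmod (w - z) ^ 2)%R.
Proof.
  intros Hz Hw.
  assert (r0 : (0 <= r)%R) by (eapply Rle_trans; [apply Cmod_ge_0|exact Hz]).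
  set (h := w - z).
  induction k as [|k IHk].
  - replace (_ - _) with (h ^ 2)
      by (unfold h; change (INR 2) with (1 + 1)%R; rewrite RtoC_plus; ring).
    rewrite Cmod_pow. pose proof (pow2_ge_0 (Cmod h)). simpl (INR _). simpl (r ^ 0)%R. lra.
  - set (n := S (S k)) in *.
    set (e := w ^ n - z ^ n - INR n * z ^ (S k) * h) in *.
    replace (w ^ (S n) - _ - _) with (w * e + INR n * z ^ (S k) * h ^ 2).
    2:{ unfold e, h. rewrite (S_INR n), RtoC_plus. subst n. rewrite !Cpow_S.
        ring. }
    eapply Rle_trans; [apply Cmod_triangle|].
    rewrite !Cmod_mult, !Cmod_pow, Cmod_INR.
    assert (H1 : (Cmod w * Cmod e
      <= r * (INR (S k) * INR n * r ^ k * Cmod h ^ 2))%R)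
      by (apply Rmult_le_compat; try apply Cmod_ge_0; assumption).
    assert (H2 : (INR n * Cmod z ^ S k * Cmod h ^ 2
      <= INR n * r ^ S k * Cmod h ^ 2)%R).
    { apply Rmult_le_compat_r; [apply pow2_ge_0|].
      apply Rmult_le_compat_l; [apply pos_INR|].
      apply pow_incr. split; [apply Cmod_ge_0|exact Hz]. }
    assert (H3 : (0 <= INR n * r ^ S k * Cmod h ^ 2)%R).
    { apply Rmult_le_pos; [apply Rmult_le_pos|apply pow2_ge_0];
        [apply pos_INR|now apply pow_le]. }
    rewrite (S_INR n). simpl (r ^ S k)%R in *.
    replace (INR n) with (INR (S k) + 1)%R in * by (unfold n; now rewrite (S_INR (S k))).
    nra.
Qed.

(** Summing [pow_taylor1_le] over the degrees; the terms of degree 0 and 1 have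
    no remainder. *)
Lemma pow_series_taylor1_le (b : nat -> C) (r : R) :
  (0 <= r)%R -> Rbar_lt r (abs_radius b) ->
  exists M : R, forall z w P Q D : C,
    (Cmod z <= r)%R -> (Cmod w <= r)%R ->
    C_is_series (fun k => b k * w ^ k) P ->
    C_is_series (fun k => b k * z ^ k) Q ->
    C_is_series (fun k => diff_coef b k * z ^ k) D ->
    (Cmod (P - Q - D * (w - z)) <= M * Cmod (w - z) ^ 2)%R.
Proof.
  intros r0 Hr.
  set (A := fun k => (Cmod (diff_coef (diff_coef b) k) * r ^ k)%R).
  assert (HA : ex_series A).
  { apply ex_series_nonneg_inside; [|assumption|].
    - intros k. apply Cmod_ge_0.
    - change (Rbar_lt r (abs_radius (diff_coef (diff_coef b)))).
      now rewrite !abs_radius_diff_coef. }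
  exists (Series A). intros z w P Q D Hz Hw HP HQ HD.
  set (h := w - z).
  set (t := fun k => b k * (w ^ k - z ^ k - INR k * z ^ (pred k) * h)).
  (* The derived series starts at degree 1, hence a shift before subtracting. *)
  assert (HD' : C_is_series (fun k => INR k * b k * z ^ (pred k)) D).
  { apply is_series_decr_1.
    replace (plus _ _) with D; [exact HD|].
    change (D = D + - (INR 0 * b 0%nat * z ^ 0)). simpl (INR 0). ring. }
  assert (Ht : C_is_series t (P - Q - D * h)).
  { assert (H := is_series_plus _ _ _ _ HP
             (is_series_plus _ _ _ _ (is_series_scal (V := C_NormedModule) (- (1) : C) _ _ HQ)
                (is_series_scal (V := C_NormedModule) (- h) _ _ HD'))).
    replace (P - Q - D * h)
      with (plus P (plus (scal (V := C_NormedModule) (- (1) : C) Q)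
                         (scal (V := C_NormedModule) (- h) D))).
    2:{ change (P + (- (1) * Q + - h * D) = P - Q - D * h). ring. }
    eapply is_series_ext; [|exact H].
    intros k. change (b k * w ^ k + (- (1) * (b k * z ^ k)
      + - h * (INR k * b k * z ^ pred k)) = t k). unfold t. ring. }
  assert (H1 : C_is_series (fun k => t (S k)) (P - Q - D * h)).
  { apply is_series_incr_1. replace (plus _ _) with (P - Q - D * h); [exact Ht|].
    change (P - Q - D * h = P - Q - D * h + t 0%nat). unfold t. simpl. ring. }
  assert (H2 : C_is_series (fun k => t (S (S k))) (P - Q - D * h)).
  { apply (is_series_incr_1 (V := C_NormedModule) (fun k => t (S k))).
    replace (plus _ _) with (P - Q - D * h); [exact H1|].
    change (P - Q - D * h = P - Q - D * h + t 1%nat). unfold t, h. simpl. ring. }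
  rewrite Rmult_comm, <- Series_scal_l.
  apply C_is_series_mod_le with (2 := ex_series_scal (V := R_NormedModule) _ _ HA) (3 := H2).
  intros k. unfold t, A, diff_coef. simpl pred.
  rewrite !Cmod_mult, !Cmod_INR.
  change (scal ?x ?y) with (x * y)%R.
  pose proof (pow_taylor1_le z w r k Hz Hw) as Hk. fold h in Hk.
  apply (Rmult_le_compat_l (Cmod (b (S (S k))))) in Hk; [|apply Cmod_ge_0].
  eapply Rle_trans; [exact Hk|]. apply Req_le. ring.
Qed.

(** * Derivative of one function with respect to another along a filter *)

(** The statement [dv/du = d] at [t0], with the increments of [u] and [v] taken
    along [F].  With [u] the inclusion of the line or the identity of the plane
    this is the usual derivative; with [u] a branch of the logarithm it allows
    differentiation in the variable [log x]. *)
Definition deriv_wrt {T : Type} (F : (T -> Prop) -> Prop) (t0 : T)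
  (u v : T -> C) (d : C) : Prop :=
  forall eps : R, (0 < eps)%R ->
    F (fun t => (Cmod (v t - v t0 - d * (u t - u t0))
                 <= eps * Cmod (u t - u t0))%R).

Definition tends_to_value {T : Type} (F : (T -> Prop) -> Prop) (t0 : T)
  (u : T -> C) : Prop :=
  forall eps : R, (0 < eps)%R -> F (fun t => (Cmod (u t - u t0) < eps)%R).

Definition C_diff_at (H : C -> C) (z d : C) : Prop :=
  forall eps : R, (0 < eps)%R -> exists delta : R, (0 < delta)%R /\
    forall w, (Cmod (w - z) < delta)%R ->
      (Cmod (H w - H z - d * (w - z)) <= eps * Cmod (w - z))%R.

Section DerivWrt.

Context {T : Type} {F : (T -> Prop) -> Prop} {FF : Filter F} (t0 : T).

Lemma deriv_wrt_ext (u v v' : T -> C) (d : C) :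
  F (fun t => v t = v' t) -> v t0 = v' t0 ->
  deriv_wrt F t0 u v d -> deriv_wrt F t0 u v' d.
Proof.
  intros E E0 H eps Heps.
  generalize (filter_and _ _ E (H eps Heps)). apply filter_imp.
  intros t [Et Ht]. now rewrite <- Et, <- E0.
Qed.

Lemma deriv_wrt_lipschitz (u v : T -> C) (d : C) :
  deriv_wrt F t0 u v d ->
  F (fun t => (Cmod (v t - v t0) <= (Cmod d + 1) * Cmod (u t - u t0))%R).
Proof.
  intros H. generalize (H 1%R Rlt_0_1). apply filter_imp. intros t Ht.
  replace (v t - v t0) with ((v t - v t0 - d * (u t - u t0)) + d * (u t - u t0))
    by ring.
  eapply Rle_trans; [apply Cmod_triangle|]. rewrite Cmod_mult. lra.
Qed.

Lemma deriv_wrt_tends_to_value (u v : T -> C) (d : C) :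
  tends_to_value F t0 u -> deriv_wrt F t0 u v d -> tends_to_value F t0 v.
Proof.
  intros Hu H eps Heps.
  assert (Hd : (0 < Cmod d + 1)%R) by (pose proof (Cmod_ge_0 d); lra).
  generalize (filter_and _ _ (deriv_wrt_lipschitz _ _ _ H)
                (Hu (eps / (Cmod d + 1))%R (Rdiv_lt_0_compat _ _ Heps Hd))).
  apply filter_imp. intros t [H1 H2].
  eapply Rle_lt_trans; [exact H1|].
  apply (Rmult_lt_compat_l _ _ _ Hd) in H2.
  replace ((Cmod d + 1) * (eps / (Cmod d + 1)))%R with eps in H2 by (field; lra).
  exact H2.
Qed.

Lemma deriv_wrt_scal (u : T -> C) (s : C) : deriv_wrt F t0 u (fun t => s * u t) s.
Proof.
  intros eps Heps. apply filter_forall. intros t.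
  replace (_ - _ - _) with (RtoC 0) by ring. rewrite Cmod_0.
  apply Rmult_le_pos; [lra|apply Cmod_ge_0].
Qed.

Lemma deriv_wrt_chain (u v w : T -> C) (d e : C) :
  deriv_wrt F t0 u v d -> deriv_wrt F t0 v w e -> deriv_wrt F t0 u w (e * d).
Proof.
  intros Hv Hw eps Heps.
  set (K := (Cmod d + 1 + Cmod e + 1)%R).
  pose proof (Cmod_ge_0 d) as d0. pose proof (Cmod_ge_0 e) as e0.
  assert (HK : (0 < K)%R) by (unfold K; lra).
  assert (Hx : (0 < eps / K)%R) by now apply Rdiv_lt_0_compat.
  generalize (filter_and _ _ (deriv_wrt_lipschitz _ _ _ Hv)
    (filter_and _ _ (Hv _ Hx) (Hw _ Hx))).
  apply filter_imp. intros t [H1 [H2 H3]].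
  set (a := Cmod (u t - u t0)) in *.
  replace (w t - w t0 - e * d * (u t - u t0))
    with ((w t - w t0 - e * (v t - v t0)) + e * (v t - v t0 - d * (u t - u t0)))
    by ring.
  eapply Rle_trans; [apply Cmod_triangle|]. rewrite Cmod_mult.
  apply (Rmult_le_compat_l _ _ _ e0) in H2.
  apply (Rmult_le_compat_l (eps / K)) in H1; [|lra].
  assert (a0 : (0 <= a)%R) by apply Cmod_ge_0.
  replace (eps * a)%R
    with (eps / K * ((Cmod d + 1) * a) + Cmod e * (eps / K * a) + eps / K * a)%R
    by (unfold K; field; unfold K in HK; lra).
  assert (0 <= eps / K * a)%R by (apply Rmult_le_pos; lra).
  lra.
Qed.

(** Since [d] is nonzero, the increment of [u] is at most [2 / |d|] times that
    of [v], so errors small relative to one are small relative to the other. *)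
Lemma deriv_wrt_inv (u v : T -> C) (d : C) :
  d <> 0 -> deriv_wrt F t0 u v d -> deriv_wrt F t0 v u (/ d).
Proof.
  intros dn H eps Heps.
  assert (d0 : (0 < Cmod d)%R) by now apply Cmod_gt_0.
  set (D := Cmod d) in *.
  assert (H1 : (0 < eps * D ^ 2 / 2)%R)
    by (apply Rdiv_lt_0_compat; [apply Rmult_lt_0_compat; [lra|now apply pow_lt]|lra]).
  assert (H2 : (0 < D / 2)%R) by lra.
  generalize (filter_and _ _ (H _ H1) (H _ H2)).
  apply filter_imp. intros t [E1 E2].
  set (x := u t - u t0) in *. set (y := v t - v t0) in *.
  assert (E3 : (D * Cmod x <= 2 * Cmod y)%R).
  { pose proof (Cmod_triangle y (- (y - d * x))) as E3.
    replace (y + - (y - d * x)) with (d * x) in E3 by ring.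
    rewrite Cmod_opp, Cmod_mult in E3. fold D in E3. lra. }
  apply (Rmult_le_reg_l D); [exact d0|].
  unfold D at 1. rewrite <- Cmod_mult.
  replace (d * (x - / d * y)) with (- (y - d * x)) by (field; exact dn).
  rewrite Cmod_opp. eapply Rle_trans; [exact E1|].
  apply (Rmult_le_compat_l (eps * D / 2)) in E3.
  - lra.
  - assert (0 < eps * D)%R by now apply Rmult_lt_0_compat. lra.
Qed.

(** The increment of [v w] differs from its linear part by the two linearization
    errors and the product of the increments; the last is of lower order because
    [u], and hence [v], tends to its value. *)
Lemma deriv_wrt_mult (u v w : T -> C) (d e : C) :
  tends_to_value F t0 u ->
  deriv_wrt F t0 u v d -> deriv_wrt F t0 u w e ->
  deriv_wrt F t0 u (fun t => v t * w t) (d * w t0 + v t0 * e).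
Proof.
  intros Hu Hv Hw eps Heps.
  set (K := (Cmod (w t0) + Cmod (v t0) + (Cmod e + 1))%R).
  pose proof (Cmod_ge_0 (w t0)) as w0. pose proof (Cmod_ge_0 (v t0)) as v0.
  pose proof (Cmod_ge_0 e) as e0.
  assert (HK : (0 < K)%R) by (unfold K; lra).
  assert (Hx : (0 < eps / K)%R) by now apply Rdiv_lt_0_compat.
  generalize (filter_and _ _ (filter_and _ _ (Hv _ Hx) (Hw _ Hx))
    (filter_and _ _ (deriv_wrt_lipschitz _ _ _ Hw)
       (deriv_wrt_tends_to_value _ _ _ Hu Hv _ Hx))).
  apply filter_imp. intros t [[H1 H2] [H3 H4]].
  set (h := u t - u t0) in *.
  replace (v t * w t - v t0 * w t0 - (d * w t0 + v t0 * e) * h)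
    with ((w t0 * (v t - v t0 - d * h) + v t0 * (w t - w t0 - e * h))
          + (v t - v t0) * (w t - w t0)) by ring.
  eapply Rle_trans; [apply Cmod_triangle|].
  eapply Rle_trans; [apply Rplus_le_compat_r, Cmod_triangle|].
  rewrite !Cmod_mult.
  apply (Rmult_le_compat_l _ _ _ w0) in H1.
  apply (Rmult_le_compat_l _ _ _ v0) in H2.
  assert (H5 : (Cmod (v t - v t0) * Cmod (w t - w t0)
                <= eps / K * ((Cmod e + 1) * Cmod h))%R)
    by (apply Rmult_le_compat; try apply Cmod_ge_0; lra).
  replace (eps * Cmod h)%R with (Cmod (w t0) * (eps / K * Cmod h)
    + Cmod (v t0) * (eps / K * Cmod h) + eps / K * ((Cmod e + 1) * Cmod h))%R
    by (unfold K; field; unfold K in HK; lra).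
  lra.
Qed.

Lemma deriv_wrt_comp (H : C -> C) (u : T -> C) (d : C) :
  tends_to_value F t0 u ->
  C_diff_at H (u t0) d ->
  deriv_wrt F t0 u (fun t => H (u t)) d.
Proof.
  intros Hu HH eps Heps. destruct (HH eps Heps) as [delta [Hd HHd]].
  generalize (Hu delta Hd). apply filter_imp. intros t Ht. now apply HHd.
Qed.

End DerivWrt.

(** * Differentiability of power series and of the exponential *)

Lemma C_diff_at_pow_series (b : nat -> C) (z : C) :
  Rbar_lt (Cmod z) (abs_radius b) ->
  C_diff_at (fun w => C_Series (fun k => b k * w ^ k)) z
    (C_Series (fun k => diff_coef b k * z ^ k)).
Proof.
  intros Hz eps Heps.
  assert (exists r : R, (Cmod z < r)%R /\ Rbar_lt r (abs_radius b)) as [r [zr Hr]].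
  { destruct (abs_radius b) as [R| |]; simpl in Hz.
    - exists ((Cmod z + R) / 2)%R. simpl. lra.
    - exists (Cmod z + 1)%R. simpl. split; [lra|exact I].
    - contradiction. }
  pose proof (Cmod_ge_0 z) as z0.
  destruct (pow_series_taylor1_le b r) as [M HM]; [lra|exact Hr|].
  set (K := (Rabs M + 1)%R).
  assert (HK : (0 < K)%R) by (unfold K; pose proof (Rabs_pos M); lra).
  exists (Rmin (r - Cmod z) (eps / K)). split.
  { apply Rmin_pos; [lra|now apply Rdiv_lt_0_compat]. }
  intros w Hw.
  assert (H1 : (Cmod (w - z) < r - Cmod z)%R)
    by (eapply Rlt_le_trans; [exact Hw|apply Rmin_l]).
  assert (H2 : (Cmod (w - z) < eps / K)%R)
    by (eapply Rlt_le_trans; [exact Hw|apply Rmin_r]).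
  assert (wr : (Cmod w < r)%R).
  { replace w with (z + (w - z)) by ring.
    eapply Rle_lt_trans; [apply Cmod_triangle|]. lra. }
  assert (in_disk : forall y, (Cmod y <= r)%R -> Rbar_lt (Cmod y) (abs_radius b))
    by (intros y Hy; exact (Rbar_le_lt_trans (Cmod y) r _ Hy Hr)).
  eapply Rle_trans.
  { apply (HM z w); try lra; apply C_Series_correct, ex_pow_series;
      rewrite ?abs_radius_diff_coef; apply in_disk; lra. }
  set (a := Cmod (w - z)) in *. assert (a0 : (0 <= a)%R) by apply Cmod_ge_0.
  assert (H3 : (M <= K)%R) by (unfold K; pose proof (Rle_abs M); lra).
  assert (H4 : (K * a <= eps)%R).
  { apply (Rmult_lt_compat_l _ _ _ HK) in H2.
    replace (K * (eps / K))%R with eps in H2 by (field; lra). lra. }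
  simpl (a ^ 2)%R. nra.
Qed.

Lemma Cexp_plus (z w : C) : Cexp (z + w) = Cexp z * Cexp w.
Proof.
  unfold Cexp. destruct z as [a b], w as [c d]. simpl.
  rewrite exp_plus, cos_plus, sin_plus.
  unfold Cmult, RtoC. simpl. f_equal; ring.
Qed.

Lemma Cexp_0 : Cexp 0 = 1.
Proof.
  unfold Cexp. simpl. rewrite exp_0, cos_0, sin_0.
  unfold Cmult, RtoC. simpl. f_equal; ring.
Qed.

Lemma Cexp_neq_0 (z : C) : Cexp z <> 0.
Proof.
  intros H. apply C1_nz. rewrite <- Cexp_0. replace (RtoC 0) with (z + - z) by ring.
  rewrite Cexp_plus, H. ring.
Qed.

Lemma diff_at_0_le (g : R -> R) (d : R) :
  is_derive g 0%R d -> forall eps : R, (0 < eps)%R ->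
  exists delta : R, (0 < delta)%R /\
    forall h, (Rabs h < delta)%R -> (Rabs (g h - g 0 - d * h) <= eps * Rabs h)%R.
Proof.
  intros H eps Heps. apply is_derive_Reals in H.
  destruct (H eps Heps) as [delta Hd]. exists delta. split; [apply cond_pos|].
  intros h Hh. destruct (Req_dec h 0) as [->|hn].
  - replace (g 0 - g 0 - d * 0)%R with 0%R by ring. rewrite Rabs_R0. lra.
  - specialize (Hd h hn Hh). rewrite Rplus_0_l in Hd.
    replace (g h - g 0 - d * h)%R with (((g h - g 0) / h - d) * h)%R by (field; exact hn).
    rewrite Rabs_mult. apply Rmult_le_compat_r; [apply Rabs_pos|lra].
Qed.

(** By the addition formula only the increment [exp h - 1 - h] from 0 matters,
    and for [h = a + i b] its real and imaginary parts are combinations of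
    [exp a - 1 - a], [cos b - 1], [sin b - b] and [a b] with bounded
    coefficients. *)
Lemma C_diff_at_Cexp (z : C) : C_diff_at Cexp z (Cexp z).
Proof.
  intros eps Heps.
  assert (Hz : (0 < Cmod (Cexp z))%R) by (apply Cmod_gt_0, Cexp_neq_0).
  (* The factor 7 is 3 + 4, the constants found below for the real and the
     imaginary part; the bound by 1 keeps the coefficient [1 + a] at most 2. *)
  set (x := Rmin (eps / (Cmod (Cexp z) * 7)) 1).
  assert (x0 : (0 < x)%R) by (apply Rmin_pos; [apply Rdiv_lt_0_compat|]; lra).
  destruct (diff_at_0_le exp (exp 0) (is_derive_exp 0%R) x x0) as [d1 [D1 H1]].
  destruct (diff_at_0_le cos _ (is_derive_cos 0%R) x x0) as [d2 [D2 H2]].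
  destruct (diff_at_0_le sin _ (is_derive_sin 0%R) x x0) as [d3 [D3 H3]].
  rewrite exp_0 in H1. rewrite sin_0, cos_0 in H2. rewrite sin_0, cos_0 in H3.
  (* Being within [x] of [z] makes the cross term [a * b] small as well. *)
  set (delta := Rmin (Rmin d1 d2) (Rmin d3 x)).
  exists delta. split; [apply Rmin_pos; apply Rmin_pos; assumption|].
  intros w Hw.
  assert (Hd : (delta <= d1 /\ delta <= d2 /\ delta <= d3 /\ delta <= x)%R).
  { unfold delta. pose proof (Rmin_l (Rmin d1 d2) (Rmin d3 x)).
    pose proof (Rmin_r (Rmin d1 d2) (Rmin d3 x)).
    pose proof (Rmin_l d1 d2). pose proof (Rmin_r d1 d2).
    pose proof (Rmin_l d3 x). pose proof (Rmin_r d3 x). lra. }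
  assert (x1 : (x <= 1)%R) by apply Rmin_r.
  set (h := w - z) in *.
  replace (Cexp w) with (Cexp z * Cexp h)
    by (rewrite <- Cexp_plus; f_equal; unfold h; ring).
  replace (_ - _ - _) with (Cexp z * (Cexp h - 1 - h)) by ring.
  rewrite Cmod_mult.
  assert (Hmain : (Cmod (Cexp h - 1 - h) <= x * 7 * Cmod h)%R).
  { pose proof (re_le_Cmod h) as Hre.
    assert (Him : (Rabs (Im h) <= Cmod h)%R).
    { eapply Rle_trans; [|apply Rmax_Cmod]. apply Rmax_r. }
    destruct h as [a b]. simpl in Hre, Him. set (m := Cmod (a, b)) in *.
    specialize (H1 a ltac:(lra)). specialize (H2 b ltac:(lra)).
    specialize (H3 b ltac:(lra)).
    replace (exp a - 1 - 1 * a)%R with (exp a - 1 - a)%R in H1 by ring.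
    replace (cos b - 1 - - 0 * b)%R with (cos b - 1)%R in H2 by ring.
    replace (sin b - 0 - 1 * b)%R with (sin b - b)%R in H3 by ring.
    assert (m0 : (0 <= m)%R) by apply Cmod_ge_0.
    assert (xm : (0 <= x * m)%R) by (apply Rmult_le_pos; lra).
    assert (Hcos : (Rabs (cos b) <= 1)%R) by (apply Rabs_le; apply COS_bound).
    assert (Hsin : (Rabs (sin b) <= 1)%R) by (apply Rabs_le; apply SIN_bound).
    assert (K1 : (Rabs (exp a - 1 - a) <= x * m)%R)
      by (eapply Rle_trans; [exact H1|apply Rmult_le_compat_l; lra]).
    assert (K2 : (Rabs (cos b - 1) <= x * m)%R)
      by (eapply Rle_trans; [exact H2|apply Rmult_le_compat_l; lra]).
    assert (K3 : (Rabs (sin b - b) <= x * m)%R)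
      by (eapply Rle_trans; [exact H3|apply Rmult_le_compat_l; lra]).
    assert (K4 : (Rabs (1 + a) <= 2)%R).
    { eapply Rle_trans; [apply Rabs_triang|]. rewrite Rabs_R1. lra. }
    assert (prod : forall p q P Q : R, (Rabs p <= P)%R -> (Rabs q <= Q)%R ->
              (Rabs (p * q) <= P * Q)%R)
      by (intros; rewrite Rabs_mult; apply Rmult_le_compat; auto; apply Rabs_pos).
    assert (Ere : (Rabs (exp a * cos b - 1 - a) <= x * m * 3)%R).
    { replace (exp a * cos b - 1 - a)%R
        with ((exp a - 1 - a) * cos b + (cos b - 1) * (1 + a))%R by ring.
      eapply Rle_trans; [apply Rabs_triang|].
      pose proof (prod _ _ _ _ K1 Hcos). pose proof (prod _ _ _ _ K2 K4). lra. }
    assert (Eim : (Rabs (exp a * sin b - b) <= x * m * 4)%R).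
    { replace (exp a * sin b - b)%R
        with ((exp a - 1 - a) * sin b + (sin b - b) * (1 + a) + a * b)%R by ring.
      eapply Rle_trans; [apply Rabs_triang|].
      eapply Rle_trans; [apply Rplus_le_compat_r, Rabs_triang|].
      assert (ax : (Rabs a <= x)%R) by lra.
      pose proof (prod _ _ _ _ K1 Hsin). pose proof (prod _ _ _ _ K3 K4).
      pose proof (prod _ _ _ _ ax Him). lra. }
    replace (Cexp (a, b) - 1 - (a, b))
      with (RtoC (exp a * cos b - 1 - a) + Ci * RtoC (exp a * sin b - b)).
    2:{ apply injective_projections; simpl; ring. }
    eapply Rle_trans; [apply Cmod_triangle|].
    rewrite Cmod_mult, Cmod_Ci, !Cmod_R. lra. }
  assert (xe : (Cmod (Cexp z) * (x * 7) <= eps)%R).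
  { assert (Hx : (x <= eps / (Cmod (Cexp z) * 7))%R) by apply Rmin_l.
    apply (Rmult_le_compat_l (Cmod (Cexp z) * 7)) in Hx; [|lra].
    replace (Cmod (Cexp z) * 7 * (eps / (Cmod (Cexp z) * 7)))%R with eps in Hx
      by (field; lra). lra. }
  apply (Rmult_le_compat_l (Cmod (Cexp z))) in Hmain; [|lra].
  apply (Rmult_le_compat_r (Cmod h)) in xe; [|apply Cmod_ge_0]. lra.
Qed.

Lemma deriv_wrt_Cpower {T : Type} {F : (T -> Prop) -> Prop} {FF : Filter F}
  (t0 : T) (L : T -> C) (s : C) :
  tends_to_value F t0 L ->
  deriv_wrt F t0 L (fun t => Cpower (L t) s) (Cpower (L t0) s * s).
Proof.
  intros HL. unfold Cpower.
  apply deriv_wrt_chain with (fun t => s * L t); [apply deriv_wrt_scal|].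
  apply (deriv_wrt_comp t0 Cexp (fun t => s * L t)); [|apply C_diff_at_Cexp].
  apply deriv_wrt_tends_to_value with (1 := HL) (2 := deriv_wrt_scal t0 L s).
Qed.

(** A continuous branch of the logarithm is differentiable because it is a right
    inverse of the exponential, whose derivative does not vanish. *)
Lemma deriv_wrt_log {T : Type} {F : (T -> Prop) -> Prop} {FF : Filter F}
  (t0 : T) (i L : T -> C) :
  tends_to_value F t0 L ->
  F (fun t => Cexp (L t) = i t) -> Cexp (L t0) = i t0 ->
  deriv_wrt F t0 i L (/ i t0).
Proof.
  intros HL HE E0. rewrite <- E0. apply deriv_wrt_inv; [apply Cexp_neq_0|].
  apply deriv_wrt_ext with (fun t => Cexp (L t)); [exact HE|exact E0|].
  apply deriv_wrt_comp; [exact HL|apply C_diff_at_Cexp].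
Qed.

(** * Hypergeometrization with lower parameter one more than the upper *)

(** The terms of a convergent series are bounded, which is enough for absolute
    convergence in every smaller disk. *)
Lemma abs_radius_ge (c : nat -> C) (z : C) :
  C_ex_series (fun k => c k * z ^ k) -> Rbar_le (Cmod z) (abs_radius c).
Proof.
  intros H. destruct (C_ex_series_bounded _ H) as [M HM].
  apply (proj1 (CV_radius_bounded (fun k => Cmod (c k)))).
  exists M. intros k. rewrite <- Cmod_pow, <- Cmod_mult.
  rewrite Rabs_pos_eq by apply Cmod_ge_0. apply HM.
Qed.

Lemma taylor_radius_le (f : C -> C) :
  Rbar_le (taylor_radius f) (abs_radius (taylor_coef f)).
Proof.
  apply (proj2 (Lub_Rbar_correct _)). intros r [z [<- Hz]].
  apply abs_radius_ge. exact Hz.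
Qed.

Lemma abs_radius_mul_bounded (b c : nat -> C) (M : R) :
  (forall k, Cmod (b k) <= M * Cmod (c k))%R ->
  Rbar_le (abs_radius c) (abs_radius b).
Proof.
  intros H. apply (proj2 (CV_radius_bounded (fun k => Cmod (c k)))).
  intros r [B HB]. apply (proj1 (CV_radius_bounded (fun k => Cmod (b k)))).
  exists (Rabs M * B)%R. intros k. specialize (HB k). specialize (H k).
  rewrite Rabs_mult in *.
  rewrite (Rabs_pos_eq (Cmod (c k))) in HB by apply Cmod_ge_0.
  rewrite (Rabs_pos_eq (Cmod (b k))) by apply Cmod_ge_0.
  assert (H1 : (Cmod (b k) <= Rabs M * Cmod (c k))%R).
  { eapply Rle_trans; [exact H|].
    apply Rmult_le_compat_r; [apply Cmod_ge_0|apply Rle_abs]. }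
  apply (Rmult_le_compat_r (Rabs (r ^ k))) in H1; [|apply Rabs_pos].
  apply (Rmult_le_compat_l (Rabs M)) in HB; [|apply Rabs_pos]. lra.
Qed.

(** Both sides are [a (a+1) ... (a+k)]. *)
Lemma pochhammer_succ_shift (a : C) (k : nat) :
  pochhammer a k * (a + INR k) = a * pochhammer (1 + a) k.
Proof.
  induction k as [|k IHk]; [simpl; ring|].
  cbn [pochhammer]. rewrite IHk, S_INR, RtoC_plus. ring.
Qed.

Lemma pochhammer_neq_0 (c : C) (k : nat) :
  (forall n : nat, c + INR n <> 0) -> pochhammer c k <> 0.
Proof.
  intros Hc. induction k as [|k IHk]; simpl; [exact C1_nz|].
  now apply Cmult_neq_0.
Qed.

Lemma bounded_below_index (g : nat -> R) (N : nat) :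
  exists M, forall k, (k < N)%nat -> (g k <= M)%R.
Proof.
  induction N as [|N [M HM]].
  - exists 0%R. intros k Hk. lia.
  - exists (Rmax M (g N)). intros k Hk.
    destruct (Nat.eq_dec k N) as [->|kN]; [apply Rmax_r|].
    eapply Rle_trans; [apply HM; lia|apply Rmax_l].
Qed.

(** For [k >= 2 |a|] the denominator has modulus at least [|a|]; finitely many
    indices remain. *)
Lemma shift_ratio_bounded (a : C) :
  (forall k : nat, a + INR k <> 0) ->
  exists M, forall k : nat, (Cmod (a / (a + INR k)) <= M)%R.
Proof.
  intros Ha. destruct (INR_unbounded (2 * Cmod a)) as [N HN].
  destruct (bounded_below_index (fun k => Cmod (a / (a + INR k))) N) as [M HM].
  exists (Rmax M 1). intros k. destruct (Nat.lt_ge_cases k N) as [Hk|Hk].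
  - eapply Rle_trans; [exact (HM k Hk)|apply Rmax_l].
  - eapply Rle_trans; [|apply Rmax_r].
    assert (Hp : (0 < Cmod (a + INR k))%R) by now apply Cmod_gt_0.
    rewrite Cmod_div by apply Ha.
    apply (Rmult_le_reg_r (Cmod (a + INR k))); [exact Hp|].
    replace (Cmod a / Cmod (a + INR k) * Cmod (a + INR k))%R with (Cmod a)
      by (field; lra).
    apply le_INR in Hk.
    pose proof (Cmod_triangle (a + INR k) (- a)) as Ht.
    replace (a + INR k + - a) with (RtoC (INR k)) in Ht by ring.
    rewrite Cmod_opp, Cmod_INR in Ht. lra.
Qed.

Definition hypergeom_coef (f : C -> C) (a : C) (k : nat) : C :=
  taylor_coef f k * (pochhammer a k / pochhammer (1 + a) k).

Lemma hypergeom_coef_shift (f : C -> C) (a : C) :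
  (forall k : nat, a + INR k <> 0) ->
  forall k : nat, hypergeom_coef f a k * (a + INR k) = a * taylor_coef f k.
Proof.
  intros a_shift k.
  assert (Hn : pochhammer (1 + a) k <> 0).
  { apply pochhammer_neq_0. intros n.
    replace (1 + a + INR n) with (a + INR (S n)); [apply a_shift|].
    rewrite S_INR, RtoC_plus. ring. }
  unfold hypergeom_coef.
  transitivity (taylor_coef f k * (pochhammer a k * (a + INR k))
                / pochhammer (1 + a) k); [field; exact Hn|].
  rewrite pochhammer_succ_shift. field. exact Hn.
Qed.

Lemma hypergeom_radius_ge (f : C -> C) (a : C) :
  (forall k : nat, a + INR k <> 0) ->
  Rbar_le (taylor_radius f) (abs_radius (hypergeom_coef f a)).
Proof.
  intros a_shift.
  apply Rbar_le_trans with (1 := taylor_radius_le f).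
  destruct (shift_ratio_bounded a a_shift) as [M HM].
  apply abs_radius_mul_bounded with M. intros k.
  replace (hypergeom_coef f a k) with (a / (a + INR k) * taylor_coef f k).
  - rewrite Cmod_mult. apply Rmult_le_compat_r; [apply Cmod_ge_0|apply HM].
  - transitivity (hypergeom_coef f a k * (a + INR k) / (a + INR k));
      [|field; apply a_shift].
    rewrite (hypergeom_coef_shift f a a_shift). field. apply a_shift.
Qed.

(** The sum over [k] of the identities [hypergeom_coef_shift], weighted by
    [w^k]. *)
Lemma hypergeom_diff_eq (f : C -> C) (a : C) (w : C) :
  (forall k : nat, a + INR k <> 0) ->
  Rbar_lt (Cmod w) (taylor_radius f) ->
  a * hypergeometrization f a (1 + a) w
  + C_Series (fun k => diff_coef (hypergeom_coef f a) k * w ^ k) * w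
  = a * taylor_sum f w.
Proof.
  intros a_shift Hw. set (b := hypergeom_coef f a) in *.
  assert (Hb := Rbar_lt_le_trans _ _ _ Hw (hypergeom_radius_ge f a a_shift)).
  assert (HP := C_Series_correct _ (ex_pow_series b w Hb)).
  assert (HT := C_Series_correct _ (ex_pow_series _ w
                  (Rbar_lt_le_trans _ _ _ Hw (taylor_radius_le f)))).
  assert (Hd : Rbar_lt (Cmod w) (abs_radius (diff_coef b)))
    by now rewrite abs_radius_diff_coef.
  assert (HD := C_Series_correct _ (ex_pow_series _ w Hd)).
  change (C_Series (fun k => b k * w ^ k))
    with (hypergeometrization f a (1 + a) w) in HP.
  change (C_Series (fun k => taylor_coef f k * w ^ k))
    with (taylor_sum f w) in HT.
  set (P := hypergeometrization f a (1 + a) w) in *.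
  set (S := taylor_sum f w) in *.
  set (D := C_Series _) in *.
  assert (HD' : C_is_series (fun k => INR k * b k * w ^ k) (D * w)).
  { apply is_series_decr_1.
    replace (plus _ _) with (scal (V := C_NormedModule) w D).
    2:{ change (w * D = D * w + - (INR 0 * b 0%nat * w ^ 0)). simpl (INR 0). ring. }
    eapply is_series_ext; [|exact (is_series_scal (V := C_NormedModule) w _ _ HD)].
    intros k. change (w * (INR (Datatypes.S k) * b (Datatypes.S k) * w ^ k)
      = INR (Datatypes.S k) * b (Datatypes.S k) * (w * w ^ k)). ring. }
  transitivity (C_Series (fun k => a * (b k * w ^ k) + INR k * b k * w ^ k)).
  { symmetry. apply C_is_series_unique.
    exact (is_series_plus _ _ _ _ (is_series_scal (V := C_NormedModule) a _ _ HP) HD'). }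
  apply C_is_series_unique.
  eapply is_series_ext; [|exact (is_series_scal (V := C_NormedModule) a _ _ HT)].
  intros k. change (a * (taylor_coef f k * w ^ k)
    = a * (b k * w ^ k) + INR k * b k * w ^ k).
  rewrite Cmult_assoc, <- (hypergeom_coef_shift f a a_shift). fold b. ring.
Qed.

Lemma C_diff_at_hypergeometrization (f : C -> C) (a : C) (w : C) :
  (forall k : nat, a + INR k <> 0) ->
  Rbar_lt (Cmod w) (taylor_radius f) ->
  C_diff_at (hypergeometrization f a (1 + a)) w
    (C_Series (fun k => diff_coef (hypergeom_coef f a) k * w ^ k)).
Proof.
  intros a_shift Hw. apply (C_diff_at_pow_series (hypergeom_coef f a)).
  exact (Rbar_lt_le_trans _ _ _ Hw (hypergeom_radius_ge f a a_shift)).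
Qed.

Lemma shift_neq_0 (a : C) :
  a <> 0 -> (forall n : nat, (1 <= n)%nat -> - a <> INR n) ->
  forall k : nat, a + INR k <> 0.
Proof.
  intros a0 Ha [|k] E.
  - apply a0. rewrite <- E. simpl. ring.
  - apply (Ha (S k)); [lia|]. transitivity (a + INR (S k) - a); [rewrite E|]; ring.
Qed.

(** The product and chain rules in the variable [l = L t], then [hypergeom_diff_eq]
    to simplify and [dl/di = 1/i] to return to the variable [i t]. *)
Lemma deriv_wrt_antiderivative {T : Type} {F : (T -> Prop) -> Prop}
  {FF : Filter F} (f : C -> C) (alpha beta : C) (t0 : T) (i L : T -> C) :
  alpha <> - (1) -> beta <> 0 ->
  (forall n : nat, (1 <= n)%nat -> - ((alpha + 1) / beta) <> INR n) ->
  tends_to_value F t0 L ->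
  F (fun t => Cexp (L t) = i t) -> Cexp (L t0) = i t0 ->
  Rbar_lt (Cmod (Cpower (L t0) beta)) (taylor_radius f) ->
  C_ex_series (taylor_term f (Cpower (L t0) beta)) /\
  C_ex_series (hypergeom_term f ((alpha + 1) / beta)
                 (1 + (alpha + 1) / beta) (Cpower (L t0) beta)) /\
  deriv_wrt F t0 i
    (fun t => Cpower (L t) (alpha + 1) / (alpha + 1) *
       hypergeometrization f ((alpha + 1) / beta)
         (1 + (alpha + 1) / beta) (Cpower (L t) beta))
    (Cpower (L t0) alpha * taylor_sum f (Cpower (L t0) beta)).
Proof.
  intros Halpha Hbeta Hn HL HE E0 Hw.
  assert (Ha1 : alpha + 1 <> 0).
  { intros E. apply Halpha. transitivity (alpha + 1 - 1); [ring|rewrite E; ring]. }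
  set (a := (alpha + 1) / beta) in *.
  assert (Ha : forall k : nat, a + INR k <> 0).
  { apply shift_neq_0; [|exact Hn]. unfold a. intros E. apply Ha1.
    transitivity ((alpha + 1) / beta * beta); [field; exact Hbeta|rewrite E; ring]. }
  set (w := Cpower (L t0) beta) in *.
  split; [|split].
  - apply ex_pow_series. exact (Rbar_lt_le_trans _ _ _ Hw (taylor_radius_le f)).
  - apply (ex_pow_series (hypergeom_coef f a)).
    exact (Rbar_lt_le_trans _ _ _ Hw (hypergeom_radius_ge f a Ha)).
  - assert (HP := deriv_wrt_Cpower t0 L (alpha + 1) HL).
    assert (HW := deriv_wrt_Cpower t0 L beta HL).
    assert (HQ := deriv_wrt_chain t0 _ _ _ _ _ HP
      (deriv_wrt_scal t0 (fun t => Cpower (L t) (alpha + 1)) (/ (alpha + 1)))).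
    assert (HH := deriv_wrt_chain t0 _ _ _ _ _ HW
      (deriv_wrt_comp t0 _ (fun t => Cpower (L t) beta) _
         (deriv_wrt_tends_to_value t0 _ _ _ HL HW)
         (C_diff_at_hypergeometrization f a w Ha Hw))).
    assert (HG := deriv_wrt_chain t0 _ _ _ _ _ (deriv_wrt_log t0 i L HL HE E0)
      (deriv_wrt_mult t0 _ _ _ _ _ HL HQ HH)).
    cbv beta in HG. fold w in HG.
    pose proof (hypergeom_diff_eq f a w Ha Hw) as Heq.
    set (P := hypergeometrization f a (1 + a) w) in *.
    set (D := C_Series _) in *.
    replace (Cpower (L t0) alpha * taylor_sum f w) with
      ((/ (alpha + 1) * (Cpower (L t0) (alpha + 1) * (alpha + 1)) * P
        + / (alpha + 1) * Cpower (L t0) (alpha + 1) * (D * (w * beta))) * / i t0).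
    + apply deriv_wrt_ext with (3 := HG); [|unfold Cdiv; ring].
      apply filter_forall. intros t. unfold Cdiv. ring.
    + assert (Ep : Cpower (L t0) (alpha + 1) = Cpower (L t0) alpha * i t0).
      { rewrite <- E0. unfold Cpower. rewrite <- Cexp_plus. f_equal. ring. }
      assert (i0 : i t0 <> 0) by (rewrite <- E0; apply Cexp_neq_0).
      assert (Es : taylor_sum f w = P + D * w * / a).
      { assert (a0 : a <> 0)
          by (intros E; apply (Ha 0%nat); rewrite E; simpl; ring).
        transitivity (a * taylor_sum f w * / a); [field; exact a0|].
        rewrite <- Heq. field. exact a0. }
      rewrite Ep, Es. unfold a. field. repeat split; assumption.
Qed.

(** * From derivatives along a filter to complex and real derivatives *)

(** [is_derive] uses on the source plane the neighbourhoods given by the modulus,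
    while [locally] on [C_UniformSpace] uses squares; both are compared through
    the norm. *)
Lemma is_derive_C_of_deriv_wrt (g : C -> C) (x d : C) :
  deriv_wrt (locally (T := C_UniformSpace) x) x (fun y => y) g d ->
  is_derive (K := C_AbsRing) (V := C_NormedModule) g x d.
Proof.
  intros H. split; [apply is_linear_scal_l|].
  intros y Hy.
  rewrite <- (is_filter_lim_locally_unique (V := AbsRing_NormedModule C_AbsRing) _ _ Hy).
  intros eps.
  assert (Hl := H eps (cond_pos eps)).
  apply (locally_norm_le_locally (V := C_NormedModule)) in Hl.
  apply (locally_le_locally_norm (V := AbsRing_NormedModule C_AbsRing)).
  revert Hl. apply filter_imp. intros z Hz.
  change (Cmod (g z - g x - (z - x) * d) <= eps * Cmod (z - x))%R.
  now rewrite (Cmult_comm (z - x)).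
Qed.

Lemma is_derive_R_of_deriv_wrt (g : R -> C) (x : R) (d : C) :
  deriv_wrt (locally (T := R_UniformSpace) x) x RtoC g d ->
  is_derive (K := R_AbsRing) (V := C_R_NormedModule) g x d.
Proof.
  intros H. split; [apply is_linear_scal_l|].
  intros y Hy.
  rewrite <- (is_filter_lim_locally_unique (V := R_NormedModule) _ _ Hy).
  intros eps. generalize (H eps (cond_pos eps)). apply filter_imp.
  intros z Hz.
  rewrite <- RtoC_minus, Cmod_R in Hz.
  change (norm (V := C_R_NormedModule)
            (g z - g x - scal (V := C_R_NormedModule) (z - x)%R d)%C
          <= eps * Rabs (z - x))%R.
  rewrite <- Cmod_norm.
  replace (scal (V := C_R_NormedModule) (z - x)%R d) with (d * RtoC (z - x)); [exact Hz|].
  destruct d as [p q]. apply injective_projections; simpl;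
    unfold scal; simpl; unfold mult; simpl; ring.
Qed.

Lemma tends_to_value_of_continuous {T : UniformSpace} (L : T -> C) (x : T) :
  continuous (T := T) (U := C_UniformSpace) L x -> tends_to_value (locally x) x L.
Proof.
  intros H eps Heps. apply (H (fun y => (Cmod (y - L x) < eps)%R)).
  apply (locally_le_locally_norm (V := C_NormedModule)).
  now exists (mkposreal eps Heps).
Qed.


(** * Antiderivative of a power times a power series *)

Theorem proposition1 :
  forall (f : C -> C) (alpha beta : C),
    holomorphic_near f 0 ->
    alpha <> - (1) ->
    beta <> 0 ->
    (forall n : nat, (1 <= n)%nat -> - ((alpha + 1) / beta) <> INR n) ->
    (forall (U : C -> Prop) (L : C -> C),
        open (T := C_UniformSpace) U ->
        C_connected U ->
        ~ U 0 ->
        log_branch U L ->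
        (forall x : C, U x ->
           Rbar_lt (Cmod (Cpower (L x) beta)) (taylor_radius f)) ->
        forall x : C, U x ->
          C_ex_series (taylor_term f (Cpower (L x) beta)) /\
          C_ex_series (hypergeom_term f ((alpha + 1) / beta)
                         (1 + (alpha + 1) / beta) (Cpower (L x) beta)) /\
          is_derive (K := C_AbsRing) (V := C_NormedModule)
            (fun y : C =>
               Cpower (L y) (alpha + 1) / (alpha + 1) *
               hypergeometrization f ((alpha + 1) / beta)
                 (1 + (alpha + 1) / beta) (Cpower (L y) beta))
            x
            (Cpower (L x) alpha * taylor_sum f (Cpower (L x) beta)))
    /\
    (forall (a b : Rbar) (L : R -> C),
        Rbar_le 0%R a ->
        log_branch_R (fun x : R => Rbar_lt a x /\ Rbar_lt x b) L ->
        (forall x : R, Rbar_lt a x /\ Rbar_lt x b ->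
           Rbar_lt (Cmod (Cpower (L x) beta)) (taylor_radius f)) ->
        forall x : R, Rbar_lt a x /\ Rbar_lt x b ->
          C_ex_series (taylor_term f (Cpower (L x) beta)) /\
          C_ex_series (hypergeom_term f ((alpha + 1) / beta)
                         (1 + (alpha + 1) / beta) (Cpower (L x) beta)) /\
          is_derive (K := R_AbsRing) (V := C_R_NormedModule)
            (fun y : R =>
               Cpower (L y) (alpha + 1) / (alpha + 1) *
               hypergeometrization f ((alpha + 1) / beta)
                 (1 + (alpha + 1) / beta) (Cpower (L y) beta))
            x
            (Cpower (L x) alpha * taylor_sum f (Cpower (L x) beta))).
Proof.
  intros f alpha beta _ Halpha Hbeta Hn. split.
  - intros U L HU _ _ HL Hr x Ux. destruct (HL x Ux) as [HLx Ex].
    destruct (deriv_wrt_antiderivative (F := locally (T := C_UniformSpace) x)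
      f alpha beta x (fun y => y) L) as [H1 [H2 H3]]; auto.
    + now apply (tends_to_value_of_continuous (T := C_UniformSpace)).
    + generalize (HU x Ux). apply filter_imp. intros y Uy. now apply HL.
    + split; [exact H1|]. split; [exact H2|]. now apply is_derive_C_of_deriv_wrt.
  - intros a b L _ HL Hr x Ix. destruct (HL x Ix) as [HLx Ex].
    destruct (deriv_wrt_antiderivative (F := locally (T := R_UniformSpace) x)
      f alpha beta x RtoC L) as [H1 [H2 H3]]; auto.
    + now apply (tends_to_value_of_continuous (T := R_UniformSpace)).
    + assert (HI : open (fun y : R => Rbar_lt a y /\ Rbar_lt y b))
        by (apply open_and; [apply open_Rbar_gt|apply open_Rbar_lt]).
      generalize (HI x Ix). apply filter_imp. intros y Iy. now apply HL.
    + split; [exact H1|]. split; [exact H2|]. now apply is_derive_R_of_deriv_wrt.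
Qed.
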